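(* Assume $\mathrm{cov}(\mathcal{N})=\mathfrak{c}$. Then there exists a maximal $\mathsf{d}$-independent family $\mathcal{A}$ such that $\mathsf{d}(A)=\frac12$ for all $A\in\mathcal{A}$.
   Context: Let $\omega=\{0,1,2,\ldots\}$ and identify $n\in\omega$ with $\{0,\ldots,n-1\}$. $\mathcal{D}$ is the family of all $A\subseteq\omega$ for which the asymptotic density $\mathsf{d}(A):=\lim_{n\to\infty}|A\cap n|/n$ exists. For $\mathcal{A}\subseteq\mathcal{P}(\omega)$, $\langle\mathcal{A}\rangle$ denotes the field of subsets of $\omega$ generated by $\mathcal{A}$. A nonempty family $\mathcal{A}\subseteq\mathcal{D}$ is $\mathsf{d}$-independent if: (1) $\mathsf{d}(A)\in(0,1)$ for all $A\in\mathcal{A}$; (2) $\langle\mathcal{A}\rangle\subseteq\mathcal{D}$; (3) $\mathsf{d}(\bigcap\mathcal{F})=\prod_{A\in\mathcal{F}}\mathsf{d}(A)$ for every nonempty finite $\mathcal{F}\subseteq\mathcal{A}$. It is a maximal $\mathsf{d}$-independent family if it is $\mathsf{d}$-independent and not properly contained in another $\mathsf{d}$-independent family. $\mathcal{N}$ is the family of subsets of $2^\omega$ that are null for the completion $\lambda$ of the usual product probability measure on $2^\omega$; $\mathrm{cov}(\mathcal{N})$ is the least cardinality of a family $\mathcal{S}\subseteq\mathcal{N}$ with $\bigcup\mathcal{S}=2^\omega$. $\mathfrak{c}=2^{\aleph_0}$. *)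

(* Defs.v *)
From HB Require Import structures.
From mathcomp Require Import all_boot all_order all_algebra finmap.
From mathcomp Require Import all_classical all_reals all_analysis.

Set Implicit Arguments.
Unset Strict Implicit.
Unset Printing Implicit Defensive.
Import Order.TTheory GRing.Theory Num.Theory.
Import numFieldNormedType.Exports.

Local Open Scope classical_set_scope.
Local Open Scope ring_scope.

Section density.
Context (R : realType).
Implicit Types (A : set nat) (AA : set (set nat)).

(* The value at n = 0 is 0 / 0 = 0, which does not affect the limit. *)
Definition initial_density A : R^nat :=
  fun n => #|[pred i : 'I_n | (i : nat) \in A]|%:R / n%:R.

Definition density_family : set (set nat) :=
  [set A | cvgn (initial_density A)].

(* Meaningful only for A in density_family. *)
Definition density A : R := limn (initial_density A).

Definition field_of_sets (T : Type) (G : set (set T)) :=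
  [/\ G setT, setU_closed G & setC_closed G].

Definition generated_field (T : Type) (G : set (set T)) : set (set T) :=
  smallest (@field_of_sets T) G.

Definition d_independent AA :=
  AA !=set0 /\ AA `<=` density_family /\
  [/\ forall A, AA A -> 0 < density A < 1,
      generated_field AA `<=` density_family &
      forall F : {fset set nat}, F != fset0 -> [set` F] `<=` AA ->
        density (\bigcap_(A in [set` F]) A) = \prod_(A <- F) density A].

Definition maximal_d_independent AA :=
  d_independent AA /\
  forall BB, d_independent BB -> AA `<=` BB -> BB = AA.

End density.

(* The product measure on 2^omega: the uniform premeasure on the algebra of   *)
(* sets depending on finitely many coordinates is extended to the generated   *)
(* (= product) sigma-algebra.                                                 *)

Definition depends_on_first (n : nat) (A : set cantor_space) :=
  forall x y : cantor_space, (forall i, (i < n)%N -> x i = y i) -> A x -> A y.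

Definition finitary (A : set cantor_space) := exists n, depends_on_first n A.

Lemma depends_on_first_le m n A : (m <= n)%N ->
  depends_on_first m A -> depends_on_first n A.
Proof. by move=> mn h x y xy; apply: h => i im; apply: xy; apply: leq_trans mn. Qed.

Lemma finitary0 : finitary set0.
Proof. by exists 0%N. Qed.

Lemma finitaryU : setU_closed finitary.
Proof.
move=> A B [m mA] [n nB]; exists (maxn m n) => x y xy [Ax|Bx]; [left|right].
- exact: (depends_on_first_le (leq_maxl m n) mA) xy Ax.
- exact: (depends_on_first_le (leq_maxr m n) nB) xy Bx.
Qed.

Lemma depends_on_firstC n A : depends_on_first n A -> depends_on_first n (~` A).
Proof. by move=> h x y xy nAx Ay; apply: nAx; apply: h Ay => i /xy ->. Qed.

Lemma finitaryC : setC_closed finitary.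
Proof. by move=> A [n /depends_on_firstC nA]; exists n. Qed.

Fact finitary_display : measure_display. Proof. exact. Qed.

HB.instance Definition _ := @isAlgebraOfSets.Build finitary_display
  cantor_space finitary finitary0 finitaryU finitaryC.

Lemma depends_on_first_open n A : depends_on_first n A -> open A.
Proof.
move=> nA; rewrite openE => x Ax.
suff : \forall y \near x, forall i : 'I_n, (y : cantor_space) i = (x : cantor_space) i.
  apply: filterS => y yx; apply: nA Ax => i ni.
  by rewrite (yx (Ordinal ni)).
apply: (@filter_forall _ _ (fun (i : 'I_n) (y : cantor_space) =>
  y i = (x : cantor_space) i) (nbhs x)) => i.
have h := @proj_continuous nat (fun=> bool) (i : nat) x.
exact: (h [set (x : cantor_space) i] (discrete_set1 _)).
Qed.

Section fair_coin_measure.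
Context (R : realType).

Definition zero_pad n (t : n.-tuple bool) : cantor_space := nth false t.

Definition uniform_prob n (A : set cantor_space) : R :=
  #|[pred t : n.-tuple bool | zero_pad t \in A]|%:R / (2 ^ n)%:R.

Lemma uniform_prob_ge0 n A : 0 <= uniform_prob n A.
Proof. by rewrite divr_ge0. Qed.

Lemma uniform_probS n A : depends_on_first n A ->
  uniform_prob n.+1 A = uniform_prob n A.
Proof.
move=> nA; rewrite /uniform_prob.
suff -> : #|[pred t : n.+1.-tuple bool | zero_pad t \in A]| =
    (#|[pred t : n.-tuple bool | zero_pad t \in A]| * 2)%N.
  by rewrite expnSr !natrM -mulf_div divff ?mulr1// pnatr_eq0.
rewrite -sum1_card -card_bool -cardX -sum1_card.
pose f (p : n.-tuple bool * bool) : n.+1.-tuple bool := [tuple of rcons p.1 p.2].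
pose g (t : n.+1.-tuple bool) : n.-tuple bool * bool :=
  ([tuple of belast (thead t) (behead t)], last (thead t) (behead t)).
have fg : cancel g f.
  move=> t; apply/val_inj; rewrite /= -lastI.
  by case/tupleP: t => a t /=; rewrite theadE.
have gf : cancel f g.
  move=> [t b]; apply/eqP; rewrite xpair_eqE; apply/andP; split.
    apply/eqP/val_inj => /=.
    have := fg (f (t, b)) => /(congr1 val) /= /rcons_inj.
    by case.
  have := fg (f (t, b)) => /(congr1 val) /= /rcons_inj.
  by case=> _ /eqP.
rewrite (reindex f); last by exists g => x _; rewrite ?fg ?gf.
apply: eq_bigl => -[t b] /=; rewrite !inE/= andbT.
apply/idP/idP; rewrite !inE; apply: nA => i ni;
  by rewrite /zero_pad/= nth_rcons size_tuple ni.
Qed.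

Lemma uniform_prob_le m n A : (m <= n)%N -> depends_on_first m A ->
  uniform_prob n A = uniform_prob m A.
Proof.
move=> /subnK <- mA; elim: (n - m)%N => // k IH.
rewrite addSn uniform_probS//; apply: depends_on_first_le mA.
exact: leq_addl.
Qed.

Definition premeasure (A : set cantor_space) : \bar R :=
  (uniform_prob (xget 0%N [set n | depends_on_first n A]) A)%:E.

Lemma premeasureE n A : depends_on_first n A ->
  premeasure A = (uniform_prob n A)%:E.
Proof.
move=> nA; rewrite /premeasure; congr EFin.
case: xgetP => [m _ /= mA|/(_ n)//].
by have [mn|/ltnW nm] := leqP m n; [rewrite (uniform_prob_le mn)|
  rewrite (uniform_prob_le nm)].
Qed.

Lemma premeasure0 : premeasure set0 = 0%E.
Proof.
rewrite (@premeasureE 0%N)//; congr EFin.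
by rewrite /uniform_prob eq_card0 ?mul0r// => t; rewrite !inE; apply/negP; rewrite inE.
Qed.

Lemma premeasure_ge0 A : (0 <= premeasure A)%E.
Proof. by rewrite lee_fin uniform_prob_ge0. Qed.

Lemma premeasure_semi_additive : measure_function.semi_additive premeasure.
Proof.
apply/(additive2P premeasure0) => A B [m mA] [n nB] AB.
set k := maxn m n.
have kA : depends_on_first k A by apply: depends_on_first_le mA; exact: leq_maxl.
have kB : depends_on_first k B by apply: depends_on_first_le nB; exact: leq_maxr.
have kAB : depends_on_first k (A `|` B).
  by move=> x y xy [Ax|Bx]; [left; exact: kA Ax|right; exact: kB Bx].
rewrite !(@premeasureE k)// -EFinD; congr EFin.
rewrite /uniform_prob -mulrDl -natrD -cardUI; congr (_%:R / _).
rewrite [X in (_ + X)%N]eq_card0 ?addn0.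
  by apply: eq_card => t; rewrite !inE in_setU.
move=> t; rewrite !inE -in_setI AB; apply/negP; by rewrite inE.
Qed.

HB.instance Definition _ := isContent.Build finitary_display cantor_space R
  premeasure premeasure_ge0 premeasure_semi_additive.

Lemma premeasure_sigma_subadditive :
  measurable_subset_sigma_subadditive premeasure.
Proof.
move=> A F mF mA AF.
have cA : compact A.
  apply: (subclosed_compact _ cantor_space_compact) => //.
  have [n nA] := mA; rewrite -[A]setCK; apply: open_closedC.
  by apply: (@depends_on_first_open n); exact: depends_on_firstC.
move: cA; rewrite compact_cover.
move=> /(_ nat setT F) [|//|D _ AD].
  by move=> i _; have [n nF] := mF i; exact: depends_on_first_open nF.
pose N := (\max_(i <- D) i).+1.
have AN : A `<=` \big[setU/set0]_(i < N) F i.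
  move=> x /AD[i /= iD Fix]; rewrite -bigcup_mkord; exists i => //=.
  by rewrite ltnS (bigD1_seq i)//= leq_maxl.
have /le_trans := @content_subadditive _ R _ premeasure A F N (fun i _ => mF i) mA AN.
apply.
rewrite -(big_mkord xpredT (fun i => premeasure (F i))).
exact: nneseries_lim_ge.
Qed.

HB.instance Definition _ := Content_SigmaSubAdditive_isMeasure.Build
  finitary_display R cantor_space premeasure premeasure_sigma_subadditive.

Definition product_measure_cantor := measure_extension premeasure.

HB.instance Definition _ := Measure.on product_measure_cantor.

(* These values on the basic open sets determine the product measure. *)
Lemma product_measure_cantor_cylinder n (s : n.-tuple bool) :
  product_measure_cantor
    [set x : cantor_space | forall i, (i < n)%N -> x i = nth false s i] =
  (2^-1 ^+ n)%:E.
Proof.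
set A := [set x | _].
have nA : depends_on_first n A by move=> x y xy Ax i ni; rewrite -xy// Ax.
rewrite /product_measure_cantor/= /measure_extension measurable_mu_extE/=; last first.
  by exists n.
rewrite (premeasureE nA) /uniform_prob; congr EFin.
rewrite (eq_card (B := pred1 s)) ?card1 ?mul1r ?natrX ?exprVn//.
move=> t; rewrite !inE; apply/idP/eqP => [|->]; rewrite ?inE// => At.
by apply/val_inj/(@eq_from_nth _ false); rewrite ?size_tuple// => i /At.
Qed.

Lemma product_measure_cantor_setT :
  product_measure_cantor [set: cantor_space] = 1%E.
Proof.
have := product_measure_cantor_cylinder [tuple].
rewrite expr0 => <-; congr product_measure_cantor.
by apply/seteqP; split.
Qed.

HB.instance Definition _ := Measure_isProbability.Build _ _ _
  product_measure_cantor product_measure_cantor_setT.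

(* The null sets of the completion: the subsets of measurable null sets. *)
Definition null_family : set (set cantor_space) :=
  [set X | product_measure_cantor.-negligible X].

Definition null_cover (S : set (set cantor_space)) :=
  S `<=` null_family /\ \bigcup_(X in S) X = [set: cantor_space].

End fair_coin_measure.

(* The least cardinality of a family satisfying P is the cardinality of K. *)
Definition least_cardinality_is (T U : Type) (P : set (set T)) (K : set U) :=
  (exists S, P S /\ (S #= K)%card) /\ forall S, P S -> (K #<= S)%card.

Definition cov_null_is (R : realType) (U : Type) (K : set U) :=
  least_cardinality_is (null_cover R) K.

(* Main.v *)
(* Well-order the subsets of omega so that initial segments have size < c, and  *)
(* build the family by recursion. At stage X, let AA be the family built so     *)
(* far (independent, all densities 1/2, size < c). If X has density d in (0, 1) *)
(* and is independent from AA, add some Y such that AA with Y is independent,   *)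
(* Y has density 1/2 and X, Y are not independent; then no X outside the final  *)
(* family can be added to it. To find Y, assume d >= 1/2 (otherwise work with   *)
(* the complement of X) and put Y = X & T, where d(B & T) = d(B) / (2 d) for    *)
(* each set B = X & (finite intersection from AA): then X & Y = Y has density   *)
(* 1/2, not d / 2. For the ratio 1/2 a suitable T exists since by the strong    *)
(* law of large numbers almost every set works for a given B, while fewer than  *)
(* c null sets do not cover; other ratios are obtained by iterating along       *)
(* binary digits.                                                               *)
From HB Require Import structures.
Require Import Defs.
From mathcomp Require Import all_boot all_order all_algebra finmap.
From mathcomp Require Import all_classical all_reals all_analysis.
From mathcomp Require Import wochoice zify ring lra.
Import Order.TTheory GRing.Theory Num.Theory.
Import numFieldNormedType.Exports.

Local Open Scope classical_set_scope.
Local Open Scope ring_scope.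

(** If a set X outside the final family could be added to it, X would meet the hypotheses of its own
    stage ([stage_nonempty]), and the set Y put in at that stage violates the product rule for X and
    Y; this is the maximality ([stages_maximal]).

    Each stage adds at most one set, so the family before X has size < c ([small_before]), and so
    does the family of its finite intersections ([card_le_seq]). Hence [exists_splitting] applies to
    them and yields Y ([exists_half_subset], [exists_spoils]); the null sets behind it come from the
    strong law [walk_negligible]. Independence passes to unions of chains because it concerns finite
    subfamilies ([half_independent_bigcup]). Densities on the generated field exist because the
    indicators of its members are linear combinations of indicators of finite intersections
    ([generated_field_density]). *)

(** * Cardinal comparability, pairing, and finite sequences *)

Lemma card_le_injP (T : Type) (U : pointedType) (A : set T) (B : set U) :
  (A #<= B)%card <-> exists2 f : T -> U, set_fun A B f & set_inj A f.
Proof. by split=> [/pcard_leP/injfunPex//|?]; apply/pcard_leP/injfunPex. Qed.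

(** The equivalence packs functionality and injectivity of a partial map into one condition. *)
Definition injective_graph (T U : Type) (G : set (T * U)) :=
  forall p q, G p -> G q -> (p.1 = q.1 <-> p.2 = q.2).

Lemma chain_bigcup2 (T : Type) (F : set (set T)) x y : total_on F subset ->
  (\bigcup_(G in F) G) x -> (\bigcup_(G in F) G) y ->
  exists2 G, F G & G x /\ G y.
Proof.
move=> totF [G FG Gx] [H FH Hy].
by have [GH|HG] := totF _ _ FG FH; [exists H|exists G] => //; split=> //;
  [exact: GH|exact: HG].
Qed.

Lemma card_le_total (T U : pointedType) (A : set T) (B : set U) :
  (A #<= B)%card \/ (B #<= A)%card.
Proof.
pose P (G : set (T * U)) := G `<=` A `*` B /\ injective_graph _ _ G.
have [F FP totF|G [[GAB injG] maxG]] := @Zorn_bigcup _ P.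
  split=> [p [G FG Gp]|p q Fp Fq]; first exact: (FP _ FG).1.
  have [G FG [Gp Gq]] := chain_bigcup2 _ _ _ _ totF Fp Fq.
  exact: (FP _ FG).2.
have [totA|/existsNP[a /not_implyP[Aa nGa]]] :=
    pselect (forall a, A a -> exists b, G (a, b)).
  left; have [f fG] : exists f : T -> U, forall a, A a -> G (a, f a).
    exists (fun a => get [set b | G (a, b)]) => a Aa.
    exact: (getPex (totA a Aa)).
  apply/card_le_injP; exists f => [a Aa|a a' /set_mem Aa /set_mem Aa' faa'].
    exact: (GAB _ (fG _ Aa)).2.
  exact/(injG _ _ (fG _ Aa) (fG _ Aa')).
have [totB|/existsNP[b /not_implyP[Bb nGb]]] :=
    pselect (forall b, B b -> exists a, G (a, b)).
  right; have [f fG] : exists f : U -> T, forall b, B b -> G (f b, b).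
    exists (fun b => get [set a | G (a, b)]) => b Bb.
    exact: (getPex (totB b Bb)).
  apply/card_le_injP; exists f => [b Bb|b b' /set_mem Bb /set_mem Bb' fbb'].
    exact: (GAB _ (fG _ Bb)).1.
  exact/(injG _ _ (fG _ Bb) (fG _ Bb')).
exfalso; apply: (maxG ((a, b) |` G)).
  split; first exact: subsetUr.
  by move=> /(_ (a, b) (or_introl erefl)) Gab; apply: nGa; exists b.
split=> [p [->//|]|p q]; first exact: GAB.
move=> [->|Gp] [->|Gq] //=; last exact: injG.
- by split=> e; [case: nGa; exists q.2|case: nGb; exists q.1];
    rewrite e -surjective_pairing.
- by split=> e; [case: nGa; exists p.2|case: nGb; exists p.1];
    rewrite -e -surjective_pairing.
Qed.

(* A maximal injective [G : B x B -> B] extending [G0] has [B] as large as [U]: *)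
(* otherwise [B] embeds in its complement as [C], and [G] extends to            *)
(* [(B u C) x (B u C)] by sending the new pairs into [C].                       *)
Lemma infinite_pairing (U : pointedType) (g : nat -> U) : injective g ->
  exists f : U * U -> U, injective f.
Proof.
move=> injg; have [c cinj] : exists c : nat * nat -> nat, injective c.
  exists choice.pickle; exact: pcan_inj choice.pickleK.
(* By the clauses of [P0], the domain of [G] is the square of [fld G], which can therefore be read
   off the diagonal. *)
pose fld (G : set (U * U * U)) := [set x | exists y, G ((x, x), y)].
pose P0 (G : set (U * U * U)) := [/\ injective_graph _ _ G,
  forall x y, fld G x -> fld G y -> exists2 z, fld G z & G ((x, y), z) &
  forall p, G p -> fld G p.1.1 /\ fld G p.1.2 ].
pose G0 := [set p | exists m n, p = ((g m, g n), g (c (m, n)))].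
have fldG0 : fld G0 = range g.
  apply/seteqP; split=> x; first by move=> [y [m [n [-> _ _]]]]; exists m.
  by move=> [m _ <-]; exists (g (c (m, m))), m, m.
have P0G0 : P0 G0.
  split.
  - move=> _ _ [m [n ->]] [m' [n' ->]] /=; split; first by move=> [/injg -> /injg ->].
    by move=> /injg/cinj[-> ->].
  - rewrite fldG0 => _ _ [m _ <-] [n _ <-]; exists (g (c (m, n))); last by exists m, n.
    by exists (c (m, n)).
  - by rewrite fldG0 => _ [m [n ->]] /=; split; [exists m|exists n].
(* Zorn's lemma also tests the empty chain; joining [G0] makes its union, the empty set,
   admissible. *)
pose P G := P0 (G0 `|` G).
have [F FP totF|G [PG maxG]] := @Zorn_bigcup _ P.
  have [[X FX]|F0] := pselect (F !=set0); last first.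
    rewrite (_ : F = set0); last by apply/seteqP; split=> // X FX; case: F0; exists X.
    by rewrite bigcup_set0 /P setU0.
  rewrite /P.
  have -> : G0 `|` \bigcup_(X in F) X = \bigcup_(X in [set G0 `|` X | X in F]) X.
    apply/seteqP; split=> p.
      by case=> [G0p|[Y FY Yp]]; [exists (G0 `|` X); [exists X|left]
        |exists (G0 `|` Y); [exists Y|right]].
    by move=> [_ [Y FY <-]] [G0p|Yp]; [left|right; exists Y].
  set F' := [set G0 `|` X | X in F].
  have F'P : F' `<=` P0 by move=> _ [Y FY <-]; exact: FP.
  have totF' : total_on F' subset.
    move=> _ _ [Y FY <-] [Z FZ <-].
    by have [YZ|ZY] := totF _ _ FY FZ; [left|right]; exact: setUS.
  have fldS H : F' H -> fld H `<=` fld (\bigcup_(X in F') X).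
    by move=> F'H x [y Hxy]; exists y, H.
  split.
  - move=> p q Fp Fq; have [H FH [Hp Hq]] := chain_bigcup2 _ _ _ _ totF' Fp Fq.
    by have [injH _ _] := F'P _ FH; exact: injH.
  - move=> x y [x' Fx] [y' Fy].
    have [H FH [Hx Hy]] := chain_bigcup2 _ _ _ _ totF' Fx Fy.
    have [_ totH _] := F'P _ FH.
    have [z Hz Hxyz] := totH x y (ex_intro _ _ Hx) (ex_intro _ _ Hy).
    by exists z; [exact: (fldS _ FH _ Hz)|exists H].
  - move=> p [H FH Hp]; have [_ _ /(_ _ Hp)[H1 H2]] := F'P _ FH.
    by split; [exact: (fldS _ FH _ H1)|exact: (fldS _ FH _ H2)].
set H := G0 `|` G in PG; have {PG}[injH totH domH] := PG.
set B := fld H.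
have gB n : B (g n) by exists (g (c (n, n))); left; exists n, n.
have [f0 f0B] : exists f0 : U * U -> U, forall x y, B x -> B y ->
    B (f0 (x, y)) /\ H ((x, y), f0 (x, y)).
  exists (fun p => get [set z | B z /\ H (p, z)]) => x y Bx By.
  have [z Bz Hz] := totH _ _ Bx By.
  by apply: (@getPex _ [set z | B z /\ H ((x, y), z)]); exists z.
have f0inj x y x' y' : B x -> B y -> B x' -> B y' -> f0 (x, y) = f0 (x', y') ->
    x = x' /\ y = y'.
  move=> Bx By Bx' By' /(injH _ _ (f0B _ _ Bx By).2 (f0B _ _ Bx' By').2).2.
  by case.
pose tag (b : bool) := g b.
have Btag b : B (tag b) by exact: gB.
have taginj : injective tag by move=> [] [] // /injg.
have [/card_le_injP[j jB jinj]|/card_le_injP[h hB hinj]] := card_le_total _ _ (~` B) B.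
  (* Two tags keep [B] and the embedded complement apart, so all of [U] injects into [B], where [f0]
     codes pairs. *)
  pose k u := if pselect (B u) then f0 (u, tag false) else f0 (j u, tag true).
  have kB u : B (k u).
    by rewrite /k; case: pselect => Bu; apply: (f0B _ _ _ _).1 => //; exact: jB.
  exists (fun p => f0 (k p.1, k p.2)).
  have kinj : injective k.
    move=> u v; rewrite /k; case: pselect => Bu; case: pselect => Bv e.
    - by have [] := f0inj _ _ _ _ Bu (Btag _) Bv (Btag _) e.
    - by have [_ /taginj] := f0inj _ _ _ _ Bu (Btag _) (jB _ Bv) (Btag _) e.
    - by have [_ /taginj] := f0inj _ _ _ _ (jB _ Bu) (Btag _) Bv (Btag _) e.
    - have [juv _] := f0inj _ _ _ _ (jB _ Bu) (Btag _) (jB _ Bv) (Btag _) e.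
      by apply: jinj; rewrite ?inE.
  by move=> [x y] [x' y'] /= /f0inj[]// /kinj -> /kinj ->.
exfalso; pose C := h @` B.
have CB x : C x -> ~ B x by move=> [b Bb <-]; exact: hB.
pose BC := B `|` C.
have [h' h'K] : exists h' : U -> U, forall x, C x -> B (h' x) /\ h (h' x) = x.
  exists (fun x => get [set b | B b /\ h b = x]) => x [b Bb hbx].
  by apply: (@getPex _ [set b | B b /\ h b = x]); exists b.
pose k x := if pselect (B x) then x else h' x.
have kB x : BC x -> B (k x).
  by rewrite /k; case: pselect => // ? [//|/h'K[]].
pose t x := tag `[< B x >].
have Bt x : B (t x) by exact: Btag.
have kinj x y : BC x -> BC y -> k x = k y -> t x = t y -> x = y.
  move=> BCx BCy + /taginj; rewrite /k.
  case: pselect => Bx; case: pselect => By //.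
  - by rewrite asboolT ?asboolF.
  - by rewrite asboolF ?asboolT.
  - move=> /= hxy _; case: BCx BCy => [//|Cx] [//|Cy].
    by rewrite -(h'K x Cx).2 -(h'K y Cy).2 hxy.
(* [k] folds both halves of [BC] into [B] and [t] records the half, so [e] codes pairs from [BC]
   injectively inside [B]. *)
pose e (x y : U) := f0 (f0 (k x, k y), f0 (t x, t y)).
have eB x y : BC x -> BC y -> B (e x y).
  by move=> BCx BCy; apply: (f0B _ _ _ _).1; apply: (f0B _ _ _ _).1 => //; exact: kB.
have einj x y x' y' : BC x -> BC y -> BC x' -> BC y' -> e x y = e x' y' ->
    x = x' /\ y = y'.
  move=> BCx BCy BCx' BCy' /f0inj[].
  1-4: by apply: (f0B _ _ _ _).1 => //; exact: kB.
  move=> /f0inj[]; [exact: kB|exact: kB|exact: kB|exact: kB|move=> kx ky /f0inj[]// tx ty].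
  by split; exact: kinj.
pose N := [set p : U * U * U | [/\ BC p.1.1, BC p.1.2, ~ (B p.1.1 /\ B p.1.2) &
  p.2 = h (e p.1.1 p.1.2)]].
have hC x : B x -> C (h x) by move=> Bx; exists x.
apply: (maxG (G `|` N)).
  split; first exact: subsetUl.
  (* The extension is proper: were the new pair [(u, u)] already in the domain of [G], [u] would lie
     in [B]. *)
  pose u := h (g 0%N); have Cu : C u := hC _ (gB 0%N).
  have Bu : ~ B u := CB _ Cu.
  move=> /(_ ((u, u), h (e u u))) NG; have {NG} GN : G ((u, u), h (e u u)).
    by apply: NG; right; split; [right|right|case|].
  have [Bh _] := domH _ (or_intror GN).
  exact: Bu Bh.
rewrite /P setUA -/H.
have fldHN : fld (H `|` N) = BC.
  apply/seteqP; split=> x.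
    by move=> [y [Hxy|[]//]]; left; exists y.
  move=> BCx; have [[y Hxy]|nBx] := pselect (B x); first by exists y; left.
  by exists (h (e x x)); right; split => //= -[].
split; rewrite ?fldHN.
- have HN p q : H p -> N q -> (p.1 = q.1 <-> p.2 = q.2).
    case: p q => [[x y] z] [[x' y'] z'] /= Hp [/= BCx BCy nB ->].
    have [/= Bx By] := domH _ Hp; split; first by move=> [xx yy]; case: nB; rewrite -xx -yy.
    move=> zh; have [z2 Bz2 Hz2] := totH _ _ Bx By.
    have := (injH _ _ Hp Hz2).1 erefl; rewrite /= zh => hz.
    by exfalso; apply: (CB z2) Bz2; rewrite -hz; apply: hC; exact: eB.
  move=> p q [Hp|Np] [Hq|Nq].
  + exact: injH.
  + exact: HN.
  + by have [? ?] := HN _ _ Hq Np; split=> /esym ?; apply/esym; auto.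
  + case: p q Np Nq => [[x y] z] [[x' y'] z'] /= [/= BCx BCy nB ->] [/= BCx' BCy' nB' ->].
    split=> [[-> ->]//|/hinj]; rewrite !inE => /(_ (eB _ _ BCx BCy) (eB _ _ BCx' BCy')).
    by move=> /einj[]// -> ->.
- move=> x y BCx BCy; have [[Bx By]|nB] := pselect (B x /\ B y).
    by have [z Bz Hz] := totH _ _ Bx By; exists z; left.
  by exists (h (e x y)); right; [apply/hC/eB|split].
- move=> p [/domH[Hp1 Hp2]|[]//]; by split; left.
Qed.

(** Iterated pairing alone does not show where a sequence ends, so its length is coded as well. *)
Lemma infinite_seq_inj (U : pointedType) (g : nat -> U) : injective g ->
  exists e : seq U -> U, injective e.
Proof.
move=> injg; have [f finj] := infinite_pairing _ _ injg.
pose c := foldr (fun x y => f (x, y)) (g 0%N).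
exists (fun s => f (g (size s), c s)) => s s' /finj[/injg].
elim: s s' => [|x s IH] [|x' s'] //= [/IH{}IH] /finj[-> /IH ->//].
Qed.

(** If [A] is finite, its finite sequences are countable; if [A] is infinite, they embed back into
    [A]. *)
Lemma card_le_seq (W : Type) (V : choiceType) (A : set V) :
  ~ ([set: W] #<= [set: nat])%card -> ~ ([set: W] #<= A)%card ->
  ~ ([set: W] #<= [set s : seq V | [set` s] `<=` A])%card.
Proof.
move=> ncount nA leWs.
have seqS (s : seq V) : [set` s] `<=` A -> exists t : seq A, map val t = s.
  elim: s => [_|x s IH sA]; first by exists [::].
  have [|t <-] := IH; first by move=> y /= ys; apply: sA; rewrite /= inE ys orbT.
  have Ax : A x by apply: sA; rewrite /= inE eqxx.
  by exists (SigSub (mem_set Ax) :: t).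
have leA : ([set s : seq V | [set` s] `<=` A] #<= [set: seq A])%card.
  apply: card_le_trans (_ : (map val @` [set: seq A] #<= _)%card); last first.
    exact: card_image_le.
  by apply: subset_card_le => s /seqS[t <-]; exists t.
have {leWs leA} leW := card_le_trans leWs leA.
have inj_le (U U' : Type) (h : U -> U') : injective h ->
    ([set: U] #<= [set: U'])%card.
  by move=> hinj; rewrite -(card_le_eql (@inj_card_eq _ _ setT h (in2W hinj))) card_leT.
have leA : ([set: A] #<= A)%card by have := card_setT A; rewrite card_eq_le => /andP[].
have geA : (A #<= [set: A])%card by have := card_setT A; rewrite card_eq_le => /andP[].
have [finA|/infiniteP leN] := pselect (finite_set A).
  apply: ncount; apply: card_le_trans leW _.
  have /card_le_injP[h _ hinj] : ([set: A] #<= [set: nat])%card.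
    exact: card_le_trans (finite_set_countable finA).
  apply: inj_le (fun s => choice.pickle (map h s)) _.
  move=> s s' /(pcan_inj choice.pickleK)/inj_map; apply=> x y.
  by move=> /hinj; rewrite !inE; exact.
have /card_leP[g'] := card_le_trans leN geA.
pose g n : A := val (g' (SigSub (mem_set (I : [set: nat] n)))).
have ginj : injective g.
  by move=> m n /val_inj /(@inj _ _ _ g'); rewrite !inE => /(_ I I) [].
pose U : pointedType := HB.pack (set_type A) (isPointed.Build (set_type A) (g 0%N)).
have [e einj] := infinite_seq_inj U g ginj.
by apply: nA; apply: card_le_trans leW (card_le_trans (inj_le _ _ e einj) leA).
Qed.

(** * Well-orderings with small initial segments *)

Definition strict_well_order (T : Type) (lt : T -> T -> Prop) :=
  [/\ well_founded lt, forall x y z, lt x y -> lt y z -> lt x z &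
      forall x y, [\/ lt x y, x = y | lt y x]].

Lemma strict_well_ordering (T : eqType) :
  exists lt : T -> T -> Prop, strict_well_order T lt.
Proof.
have [R woR] := well_ordering_principle T.
have minR (A : set T) : A !=set0 -> exists2 z, A z & forall y, A y -> R z y.
  move=> [x Ax]; have [|z [[/asboolP Az zA] _]] := woR (fun x => `[< A x >]).
    by exists x; apply/asboolP.
  by exists z => // y Ay; apply: zA; apply/asboolP.
have Rxx x : R x x.
  by have [_ -> /(_ x erefl)] := minR [set x] (ex_intro _ x erefl).
have Ranti x y : R x y -> R y x -> x = y.
  move=> Rxy Ryx; have [|z [_ zuniq]] := woR [pred z | (z == x) || (z == y)].
    by exists x; rewrite inE eqxx.
  transitivity z; [apply/esym|]; apply: zuniq; split; rewrite ?inE ?eqxx ?orbT//;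
    by move=> w; rewrite inE => /orP[]/eqP->.
exists (fun x y => ~~ R y x); split.
- move=> x; apply: contrapT => nx.
  have [z nz minz] := minR [set x | ~ Acc (fun x y => ~~ R y x) x] (ex_intro _ x nx).
  by apply: nz; constructor => y /negP nRzy; apply: contrapT => /minz.
- move=> x y z /negP nyx /negP nzy; apply/negP => Rzx.
  have [|m] := minR [set x; y; z]; first by exists x; left; left.
  move=> -[[]|] -> /[dup] Rx.
  + move=> /(_ z (or_intror erefl)) /Ranti /(_ Rzx) xz.
    by apply: nzy; rewrite -xz; apply: Rx; left; right.
  + by move=> /(_ x (or_introl (or_introl erefl))).
  + by move=> /(_ y (or_introl (or_intror erefl))).
- move=> x y; case: (boolP (R y x)) => [Ryx|]; last by constructor 1.
  case: (boolP (R x y)) => [Rxy|]; last by constructor 3.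
  by constructor 2; exact: Ranti.
Qed.

(** If some initial segment is as large as [T], take the least [x] with such a segment and pull the
    order back along an injection of [T] into it. Segments of the new order embed in segments below
    [x], which are small by minimality. *)
Lemma initial_well_ordering (T : pointedType) :
  exists2 lt : T -> T -> Prop, strict_well_order T lt &
    forall x, ~ ([set: T] #<= [set y | lt y x])%card.
Proof.
have [lt [wf tr tri]] := strict_well_ordering T.
have [small|] := pselect (forall x, ~ ([set: T] #<= [set y | lt y x])%card).
  by exists lt.
move=> /existsNP[x0 /contrapT big0].
have [x [big minx]] : exists x, ([set: T] #<= [set y | lt y x])%card /\
    forall y, lt y x -> ~ ([set: T] #<= [set z | lt z y])%card.
  apply: contrapT => none; move: x0 big0.
  apply: (well_founded_ind wf) => x IH big; apply: none; exists x; split=> //.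
have /card_le_injP[f fx finj] := big.
have {}finj : injective f by move=> s t /finj; rewrite !inE; exact.
exists (fun s t => lt (f s) (f t)); first split.
- move=> s; move: {2}(f s) (erefl (f s)) => u.
  elim/(well_founded_ind wf): u s => u IH s fs.
  by constructor => s' lts; apply: (IH _ _ s' erefl); rewrite -fs.
- by move=> s t u; exact: tr.
- move=> s t; have [?|/finj->|?] := tri (f s) (f t).
  + by constructor 1.
  + by constructor 2.
  + by constructor 3.
move=> t big'; apply: (minx (f t) (fx t I)); apply: card_le_trans big' _.
by apply/card_le_injP; exists f => // s s' _ _ /finj.
Qed.

(** * Second moments of weighted coin-tossing walks *)

Lemma sum_tuple_rcons (V : nmodType) n (F : n.+1.-tuple bool -> V) :
  \sum_t F t = \sum_(t : n.-tuple bool) \sum_b F [tuple of rcons t b].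
Proof.
rewrite pair_big /=.
pose f (p : n.-tuple bool * bool) : n.+1.-tuple bool := [tuple of rcons p.1 p.2].
have finj : injective f.
  by move=> [t b] [t' b'] /(congr1 val)/rcons_inj[/val_inj -> ->].
have : bijective f.
  by apply: inj_card_bij => //; rewrite card_prod !card_tuple card_bool expnSr.
by move=> fbij; rewrite (reindex f)//=; exact: onW_bij.
Qed.

Section fair_coin_walk.
Context (R : realType).
Implicit Types (w : nat -> R) (x : nat -> bool).

(** For [w] the indicator of B, this is the number of elements of B below n outside x minus the
    number inside x. *)
Definition walk w x n : R := \sum_(i < n) w i * (-1) ^+ x i.

Lemma walk_norm_le w x n : (forall i, `|w i| <= 1) -> `|walk w x n| <= n%:R.
Proof.
move=> w1; apply: le_trans (ler_norm_sum _ _ _) _.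
rewrite -[leRHS]mulr1 mulr_natl -[n in leRHS]card_ord -sumr_const.
by apply: ler_sum => i _; rewrite normrM normr_sign mulr1.
Qed.

Lemma walk_norm_le_shift w x m n : (forall i, `|w i| <= 1) -> (m <= n)%N ->
  `|walk w x n| <= `|walk w x m| + (n - m)%:R.
Proof.
move=> w1 /subnKC <-; rewrite addKn; move: (n - m)%N => {}n.
have -> : walk w x (m + n) =
    walk w x m + walk (fun i => w (m + i)%N) (fun i => x (m + i)%N) n.
  by rewrite /walk big_split_ord.
by apply: le_trans (ler_normD _ _) _; rewrite lerD2l walk_norm_le.
Qed.

(** The steps are orthogonal: summing over the last coin cancels the cross term. *)
Lemma sum_walk_sqr w n :
  \sum_(t : n.-tuple bool) walk w (zero_pad t) n ^+ 2 =
  (2 ^ n)%:R * \sum_(i < n) w i ^+ 2.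
Proof.
elim: n => [|n IH].
  rewrite big_ord0 mulr0 big1// => t _.
  by rewrite /walk big_ord0 expr0n.
rewrite sum_tuple_rcons big_ord_recr /= mulrDr [in X in _ = X + _]expnS.
rewrite natrM -mulrA -IH.
have step (t : n.-tuple bool) b :
    walk w (zero_pad [tuple of rcons t b]) n.+1 =
    walk w (zero_pad t) n + w n * (-1) ^+ b.
  rewrite /walk big_ord_recr /= /zero_pad /= nth_rcons size_tuple ltnn eqxx.
  congr (_ + _); apply: eq_bigr => i _.
  by rewrite nth_rcons size_tuple ltn_ord.
under eq_bigr do rewrite big_bool !step /= expr1 expr0 mulr1 mulrN1.
transitivity (\sum_(t : n.-tuple bool) (2 * walk w (zero_pad t) n ^+ 2 + 2 * w n ^+ 2)).
  by apply: eq_bigr => t _; ring.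
rewrite big_split /= -mulr_sumr; congr (_ + _).
by rewrite sumr_const card_tuple card_bool expnSr natrM -[LHS]mulr_natl mulrA.
Qed.

Lemma depends_on_first_walk w n (P : R -> Prop) :
  depends_on_first n [set x | P (walk w x n)].
Proof.
move=> x y xy /=; suff -> : walk w x n = walk w y n by [].
by apply: eq_bigr => i _; rewrite xy.
Qed.

Lemma walk_chebyshev w n (a : R) : (forall i, `|w i| <= 1) -> 0 < a ->
  (product_measure_cantor R [set x | (a <= `|walk w x n|)%R] <= (n%:R / a ^+ 2)%:E)%E.
Proof.
move=> w1 a0; have nE := @depends_on_first_walk w n (fun r => a <= `|r|).
rewrite /product_measure_cantor/= /measure_extension measurable_mu_extE/=; last by exists n.
rewrite (premeasureE _ nE) lee_fin /uniform_prob.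
rewrite ler_pdivrMr ?ltr0n ?expn_gt0// mulrAC ler_pdivlMr ?exprn_gt0//.
apply: (@le_trans _ _ (\sum_(t : n.-tuple bool) walk w (zero_pad t) n ^+ 2)).
  rewrite -sum1_card natr_sum mulr_suml.
  rewrite [leLHS]big_mkcond /=; apply: ler_sum => t _; rewrite inE.
  case: ifPn => [/set_mem /= aw|_]; last exact: sqr_ge0.
  by rewrite mul1r -[leRHS]real_normK ?num_real// lerXn2r ?nnegrE// ltW.
rewrite sum_walk_sqr mulrC ler_pM2r ?ltr0n ?expn_gt0//.
rewrite -[leRHS]mulr1 mulr_natl -[n in leRHS]card_ord -sumr_const.
by apply: ler_sum => i _; rewrite -real_normK ?num_real// expr_le1.
Qed.

Lemma sum_inv_sqr_le n : \sum_(0 <= k < n) k.+1%:R ^- 2 <= 2 :> R.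
Proof.
(* This sharper bound is inductive, because (z + 1)^-2 is at most 1/z - 1/(z + 1). *)
suff : \sum_(0 <= k < n.+1) k.+1%:R ^- 2 <= 2 - n.+1%:R^-1 :> R.
  rewrite big_nat_recr//= => le2; apply: (@le_trans _ _ (2 - n.+1%:R^-1)).
    by apply: le_trans le2; rewrite lerDl invr_ge0 exprn_ge0.
  by rewrite gerBl invr_ge0.
elim: n => [|n IH]; first by rewrite big_nat1 expr1n invr1; lra.
rewrite big_nat_recr//=; apply: le_trans (lerD IH (lexx _)) _.
have n0 : 0 < n.+1%:R :> R by rewrite ltr0n.
rewrite -[n.+2%:R]natr1; set z : R := n.+1%:R in n0 *.
have z10 : 0 < z + 1 by lra.
have -> : 2 - z^-1 + (z + 1) ^- 2 = 2 - (z + 1)^-1 - z^-1 * (z + 1) ^- 2.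
  by field; rewrite !gt_eqF.
by rewrite gerBl mulr_ge0// invr_ge0 ?exprn_ge0// ltW.
Qed.

End fair_coin_walk.

(** * The strong law of large numbers for these walks *)

Lemma fourth_root_floor m n : (m ^ 4 <= n)%N ->
  exists k, [/\ (m <= k)%N, (k ^ 4 <= n)%N & (n < k.+1 ^ 4)%N].
Proof.
move=> mn; pose P k := (k ^ 4 <= n)%N.
have Pn k : P k -> (k <= n)%N by 
  by apply: leq_trans; case: k => // k; rewrite -[leqLHS]expn1 leq_pexp2l.
have [k Pk maxk] := ex_maxnP (ex_intro P m mn) Pn.
by exists k; split=> //; [exact: maxk|rewrite ltnNge; apply/negP => /maxk; rewrite ltnn].
Qed.

Section strong_law.
Context (R : realType).
Implicit Types (w : nat -> R) (x : nat -> bool).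

(* Chebyshev along the fourth powers bounds the walk by [k ^ 3] at time [k ^ 4] *)
(* for almost all [k]; between [k ^ 4] and [k.+1 ^ 4] it moves by at most       *)
(* [15 * k ^ 3].                                                                *)
Lemma walk_negligible w : (forall i, `|w i| <= 1) ->
  (product_measure_cantor R).-negligible
    [set x | ~ (walk R w x n / n%:R @[n --> \oo] --> (0 : R))].
Proof.
move=> w1; pose F k : set cantor_space :=
  [set x | k.+1%:R ^+ 3 <= `|walk R w x (k.+1 ^ 4)|].
have finF k : finitary (F k).
  exists (k.+1 ^ 4)%N.
  exact: (@depends_on_first_walk R w _ (fun r => k.+1%:R ^+ 3 <= `|r|)).
have mF k : measurable (F k : set (g_sigma_algebraType finitary)).
  exact: sub_gen_smallest.
(* Borel-Cantelli: with j = k + 1, Chebyshev bounds the measure of [F k] by j^4 / j^6 = j^-2, which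
   is summable. *)
have F0 : product_measure_cantor R (lim_sup_set F) = 0%E.
  apply: lim_sup_set_cvg0 => //.
  apply: (@le_lt_trans _ _ 2%:E); last exact: ltry.
  apply: lime_le; first exact: is_cvg_nneseries.
  apply: nearW => n.
  apply: le_trans (_ : (\sum_(0 <= k < n) (k.+1%:R ^- 2)%:E <= _)%E); last first.
    by rewrite sumEFin lee_fin sum_inv_sqr_le.
  apply: lee_sum => k _; apply: le_trans (walk_chebyshev R w _ _ w1 _) _.
    by rewrite exprn_gt0// ltr0n.
  rewrite lee_fin natrX -exprM -[(3 * 2)%N]/(4 + 2)%N exprD invfM mulrA.
  by rewrite mulfV ?mul1r// expf_neq0// pnatr_eq0.
have mlF : measurable (lim_sup_set F : set (g_sigma_algebraType finitary)).
  by apply: bigcapT_measurable => n; exact: bigcup_measurable.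
apply: negligibleS (_ : (product_measure_cantor R).-negligible (lim_sup_set F)); last first.
  exact/negligibleP.
move=> x; apply: contra_notP => /existsNP[K /not_implyP[_ notF]].
apply/cvgr0Pnorm_le => e e0.
(* From [m] on, k is past the last bad event ([F] is indexed from k - 1), and k >= 16 / e turns 16
   k^3 into at most e k^4. *)
pose m := maxn K.+1 (Num.truncn (16 / e)).+1.
exists (m ^ 4)%N => // n /= /fourth_root_floor[k [mk kn nk]].
have k0 : (0 < k)%N by apply: leq_trans mk; rewrite /m leq_max.
have n0 : (0 < n)%N by apply: leq_trans kn; rewrite expn_gt0 k0.
have walk_k : `|walk R w x (k ^ 4)| <= k%:R ^+ 3.
  rewrite leNgt; apply/negP => /ltW wk; apply: notF; exists k.-1 => /=.
    by rewrite -ltnS prednK// (leq_trans _ mk)// leq_max leqnn.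
  by rewrite /F /= prednK.
have walk_n : `|walk R w x n| <= 16 * k%:R ^+ 3.
  apply: le_trans (walk_norm_le_shift R w x _ _ w1 kn) _.
  have : (n - k ^ 4 <= 15 * k ^ 3)%N by nia.
  rewrite -(ler_nat R) natrM natrX => ?; lra.
have kR : 0 < k%:R :> R by rewrite ltr0n.
rewrite normrM normfV normr_nat ler_pdivrMr ?ltr0n//.
apply: le_trans walk_n _; apply: (@le_trans _ _ (e * k%:R ^+ 4)); last first.
  by rewrite ler_pM2l// -natrX ler_nat.
have : 16 / e <= k%:R.
  apply: le_trans (ltW (truncnS_gt _)) _; rewrite ler_nat.
  by apply: leq_trans mk; rewrite leq_max leqnn orbT.
rewrite ler_pdivrMr// => ek.
by rewrite [k%:R ^+ 4]exprS mulrA ler_pM2r ?exprn_gt0// mulrC.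
Qed.

End strong_law.

(** * Densities as Cesaro means, and splitting sets in a given ratio *)

Section means.
Context (R : realType).
Implicit Types (f g : nat -> R) (A B : set nat).

Definition mean f n : R := (\sum_(i < n) f i) / n%:R.

Definition has_mean f (r : R) := mean f n @[n --> \oo] --> r.

Lemma initial_densityE A : initial_density R A = mean \1_A.
Proof.
apply/funext => n; rewrite /initial_density /mean; congr (_ / _).
by rewrite -sum1_card natr_sum big_mkcond; apply: eq_bigr => i _; rewrite inE /indic; case: ifP.
Qed.

Lemma has_mean_unique f r s : has_mean f r -> has_mean f s -> r = s.
Proof. by move=> fr fs; exact: (@cvg_unique _ _ _ _ r s fr fs). Qed.

Lemma has_meanD f g r s : has_mean f r -> has_mean g s -> has_mean (f \+ g) (r + s).
Proof.
move=> fr gs; rewrite /has_mean.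
rewrite (_ : mean (f \+ g) = mean f \+ mean g); first exact: cvgD.
by apply/funext => n; rewrite /mean /= big_split mulrDl.
Qed.

Lemma has_meanZ a f r : has_mean f r -> has_mean (a \*o f) (a * r).
Proof.
move=> fr; rewrite /has_mean.
rewrite (_ : mean (a \*o f) = a \*o mean f); first exact: cvgMr.
by apply/funext => n; rewrite /mean /= -mulr_sumr mulrA.
Qed.

Lemma has_meanB f g r s : has_mean f r -> has_mean g s -> has_mean (f \- g) (r - s).
Proof.
move=> fr gs; have := has_meanD _ _ _ _ fr (has_meanZ (-1) _ _ gs).
rewrite mulN1r; congr has_mean.
by apply/funext => n /=; rewrite mulN1r.
Qed.

Lemma has_mean0 : has_mean (cst 0) 0.
Proof.
rewrite /has_mean (_ : mean (cst 0) = cst 0); first exact: cvg_cst.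
by apply/funext => n; rewrite /mean big1 ?mul0r.
Qed.

Lemma has_mean1 : has_mean (cst 1) 1.
Proof.
apply/cvgrPdist_lt => e e0; exists 1%N => // n /= n0.
by rewrite /mean sumr_const card_ord divff ?subrr ?normr0// pnatr_eq0 -lt0n.
Qed.

Lemma has_mean_setU A B r s : A `&` B = set0 ->
  has_mean \1_A r -> has_mean \1_B s -> has_mean \1_(A `|` B) (r + s).
Proof.
move=> AB Ar Bs; rewrite (_ : \1_(A `|` B) = \1_A \+ \1_B); first exact: has_meanD.
apply/funext => i; rewrite /indic in_setU /=.
have := in_setI i A B; rewrite AB in_set0.
by case: (i \in A); case: (i \in B); rewrite //= ?addr0 ?add0r.
Qed.

Lemma has_mean_setD A B r s : has_mean \1_A r -> has_mean \1_(A `&` B) s ->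
  has_mean \1_(A `\` B) (r - s).
Proof.
move=> Ar ABs; rewrite (_ : \1_(A `\` B) = \1_A \- \1_(A `&` B)); first exact: has_meanB.
apply/funext => i; rewrite /indic /= in_setD in_setI.
by case: (i \in A); case: (i \in B); rewrite //= ?subr0 ?subrr.
Qed.

Lemma le_mean_indic A B n : A `<=` B -> mean \1_A n <= mean \1_B n.
Proof.
move=> AB; rewrite ler_wpM2r ?invr_ge0//; apply: ler_sum => i _.
rewrite /indic ler_nat; case: (boolP (_ \in A)) => // /set_mem /AB.
by move=> /mem_set ->.
Qed.

Lemma has_mean_indic_ge0 A r : has_mean \1_A r -> 0 <= r.
Proof.
move=> Ar; rewrite -(cvg_lim _ Ar)//; apply: limr_ge; first exact: cvgP Ar.
by apply: nearW => n; rewrite /mean divr_ge0// sumr_ge0// => i _; rewrite /indic ler0n.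
Qed.

(** Gives existence of the mean, not only its value; used for a countable union, to which densities
    do not pass in general. *)
Lemma has_mean_squeeze A r :
  (forall e, 0 < e -> exists L U l u, [/\ L `<=` A, A `<=` U,
     has_mean \1_L l, has_mean \1_U u & r - e <= l /\ u <= r + e]) ->
  has_mean \1_A r.
Proof.
move=> sq; apply/cvgrPdist_le => e e0.
have [|L [U [l [u [LA AU + + [rl ur]]]]]] := sq (e / 2); first by rewrite divr_gt0.
rewrite /has_mean => /cvgrPdist_le Ll /cvgrPdist_le Uu.
have e20 : 0 < e / 2 by rewrite divr_gt0.
near=> n.
have : `|l - mean \1_L n| <= e / 2 by near: n; exact: Ll.
have : `|u - mean \1_U n| <= e / 2 by near: n; exact: Uu.
have := le_mean_indic _ _ n LA; have := le_mean_indic _ _ n AU.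
rewrite !ler_norml => ? ? /andP[? ?] /andP[? ?]; apply/andP; split; lra.
Unshelve. all: by end_near. Qed.

(** By comparability of cardinals this says that [AA] has size < c. *)
Definition small_family (AA : set (set nat)) := ~ ([set: nat -> bool] #<= AA)%card.

Lemma small_image (AA : set (set nat)) (h : set nat -> set nat) :
  small_family AA -> small_family (h @` AA).
Proof. by move=> sA sh; apply: sA; apply: card_le_trans sh (card_image_le _ _). Qed.

Hypothesis cov_null : forall S, null_cover R S -> ([set: nat -> bool] #<= S)%card.

(** Each B excludes only the null set of x for which its walk is not o(n), and fewer than c null
    sets leave some x. For this x, the indicator of B & Y is half the difference of the indicator of
    B and the signed one. *)
Lemma exists_fair_splitting (BB : set (set nat)) : small_family BB ->
  exists Y, forall B, BB B -> forall b, has_mean \1_B b -> has_mean \1_(B `&` Y) (b / 2).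
Proof.
move=> small.
pose N B : set cantor_space :=
  [set x | ~ (walk R \1_B x n / n%:R @[n --> \oo] --> (0 : R))].
have [x Nx] : exists x, forall B, BB B -> ~ N B x.
  apply: contrapT => none; apply: small.
  apply: card_le_trans (card_image_le N BB); apply: cov_null; split.
    move=> _ [B _ <-]; apply: walk_negligible => i.
    by rewrite ger0_norm ?ler0n// /indic lern1 leq_b1.
  apply/seteqP; split=> // x _; apply: contrapT => nx; apply: none.
  by exists x => B BB_B NBx; apply: nx; exists (N B) => //; exists B.
exists [set i | x i] => B BB_B b Bb.
have := Nx _ BB_B => /contrapT walk0.
have : has_mean (fun i => \1_B i * (-1) ^+ x i) 0 by exact: walk0.
move=> /(has_meanB _ _ _ _ Bb)/(has_meanZ 2^-1); rewrite subr0 mulrC.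
congr has_mean; apply/funext => i /=.
rewrite /indic in_setI; have -> : (i \in [set i | x i]) = x i.
  by apply/idP/idP => [/set_mem//|xi]; exact: mem_set.
by case: (i \in B); case: (x i) => /=; lra.
Qed.

(* The set is built from the binary digits of [t] by bisection: the state is    *)
(* [(L, M, s)] with [L] decided to be in, [M] undecided, and [s] the fraction   *)
(* of [M] still to be put in.                                                   *)
Lemma exists_splitting (BB : set (set nat)) (t : R) : small_family BB -> 0 <= t <= 1 ->
  exists T, forall B, BB B -> forall b, has_mean \1_B b -> has_mean \1_(B `&` T) (t * b).
Proof.
move=> small t01.
(* [r M] halves [B & M] for all B at once; the traces on [M] still form a small family. *)
have /choice[r rP] : forall M, exists Y, forall B, BB B -> forall b,
    has_mean \1_(B `&` M) b -> has_mean \1_(B `&` M `&` Y) (b / 2).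
  move=> M; have [Y hY] := exists_fair_splitting _ (small_image _ (fun B => B `&` M) small).
  by exists Y => B BB_B; apply: hY; exists B.
pose step (p : set nat * set nat * R) := let: (L, M, s) := p in
  if 2^-1 <= s then (L `|` (M `&` r M), M `\` r M, 2 * s - 1)
  else (L, M `&` r M, 2 * s).
pose st m := iter m step (set0, setT, t).
pose L m := (st m).1.1; pose M m := (st m).1.2; pose s m := (st m).2.
have stE m : st m = (L m, M m, s m) by rewrite /L /M /s; case: (st m) => -[].
have stS m : st m.+1 = step (L m, M m, s m) by rewrite -stE.
have s01 m : 0 <= s m <= 1.
  elim: m => [|m IH]; first exact: t01.
  by rewrite /s stS /=; case: ifPn IH; rewrite -?ltNge /=; lra.
have LM m : L m `&` M m = set0.
  elim: m => [|m IH]; first by rewrite /L /= set0I.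
  rewrite -subset0 -[X in _ `<=` X]IH /L /M stS /=; case: ifP => _ /= i.
    by move=> [[Li|[_ ri]]] [Mi nri].
  by move=> [Li [Mi _]].
have LS m : L m `<=` L m.+1.
  by rewrite {2}/L stS /=; case: ifP => _ //=; exact: subsetUl.
have LMS m : L m.+1 `|` M m.+1 `<=` L m `|` M m.
  rewrite {1}/L {1}/M stS /=; case: ifP => _ /= i.
    by move=> [[Li|[Mi _]]|[Mi _]]; [left|right|right].
  by move=> [Li|[Mi _]]; [left|right].
have Lmono m n : (m <= n)%N -> L m `<=` L n.
  move=> /subnKC <-; elim: (n - m)%N => [|k IH]; first by rewrite addn0.
  by rewrite addnS; apply: subset_trans IH (LS _).
have LMmono m n : (m <= n)%N -> L n `|` M n `<=` L m `|` M m.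
  move=> /subnKC <-; elim: (n - m)%N => [|k IH]; first by rewrite addn0.
  by rewrite addnS; apply: subset_trans (LMS _) IH.
(* The bisection invariant: within each B, [M m] has relative density 2^-m and [L m] falls short of
   t by s m * 2^-m. *)
have mu m B b : BB B -> has_mean \1_B b ->
    has_mean \1_(B `&` M m) (2^-1 ^+ m * b) /\
    has_mean \1_(B `&` L m) ((t - s m * 2^-1 ^+ m) * b).
  move=> BB_B Bb; elim: m => [|m [IHM IHL]].
    rewrite /M /L /s /= setIT setI0 expr0 mulr1 subrr mul0r mul1r; split=> //.
    by rewrite indic0; exact: has_mean0.
  have IHr := rP _ _ BB_B _ IHM.
  rewrite /M /L /s stS /=; case: ifPn => _ /=; split.
  - rewrite setIDA; have := has_mean_setD _ _ _ _ IHM IHr; congr has_mean.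
    by rewrite exprSr; field.
  - rewrite setIUr setIA.
    have BLM : B `&` L m `&` (B `&` M m `&` r (M m)) = set0.
      by rewrite -subset0 -(LM m) => i [[_ Li] [[_ Mi] _]].
    have := has_mean_setU _ _ _ _ BLM IHL IHr; congr has_mean.
    by rewrite exprSr; field.
  - rewrite setIA; have := IHr; congr has_mean.
    by rewrite exprSr; field.
  - have := IHL; congr has_mean.
    by rewrite exprSr; field.
exists (\bigcup_m L m) => B BB_B b Bb; apply: has_mean_squeeze => e e0.
have b0 := has_mean_indic_ge0 _ _ Bb.
have [m me] : exists m, 2^-1 ^+ m * b <= e.
  exists (Num.truncn (b / e)).+1; set m := _.+1.
  rewrite exprVn ler_pdivrMl ?exprn_gt0// -ler_pdivrMr//.
  apply: le_trans (ltW (truncnS_gt _)) _.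
  by rewrite -natrX ler_nat ltnW// ltn_expl.
exists (B `&` L m), (B `&` (L m `|` M m)), ((t - s m * 2^-1 ^+ m) * b),
  ((t - s m * 2^-1 ^+ m) * b + 2^-1 ^+ m * b).
have [mM mL] := mu m _ _ BB_B Bb.
split.
- by move=> i [Bi Li]; split=> //; exists m.
- move=> i [Bi [k _ Lki]]; split => //.
  have [mk|km] := leqP m k; first by apply: (LMmono _ _ mk); left.
  by left; apply: (Lmono _ _ (ltnW km)).
- by [].
- rewrite setIUr; apply: has_mean_setU => //.
  by rewrite -subset0 -(LM m) => i [[_ Li] [_ Mi]].
- have q0 : 0 <= 2^-1 ^+ m * b by rewrite mulr_ge0 ?exprn_ge0 ?invr_ge0.
  have /andP[s0 s1] := s01 m.
  have : s m * (2^-1 ^+ m * b) <= 2^-1 ^+ m * b by rewrite ler_piMl.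
  have : 0 <= s m * (2^-1 ^+ m * b) by rewrite mulr_ge0.
  rewrite mulrBl -mulrA; split; lra.
Qed.

End means.

Lemma cantor_uncountable : ~ ([set: nat -> bool] #<= [set: nat])%card.
Proof.
move=> /card_le_injP[f _ finj].
pose x n := `[< exists2 y : nat -> bool, f y = n & y n = false >].
have fy y : f y = f x -> y = x by move=> fyx; apply: finj; rewrite ?inE.
case xfx : (x (f x)).
  by have /asboolP[y /fy ->] := xfx; rewrite xfx.
by have /asboolPn[] := negbT xfx; exists x.
Qed.

(** * Independent families of sets of density 1/2, and spoilers *)

Section independence.
Context (R : realType).
Implicit Types (AA BB : set (set nat)) (F : {fset set nat}) (X Y Z : set nat).

Definition fsetI F : set nat := \bigcap_(A in [set` F]) A.

Lemma fsetI0 : fsetI fset0 = setT.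
Proof. by rewrite /fsetI set_fset0 bigcap_set0. Qed.

Lemma fsetIU F G : fsetI (F `|` G)%fset = fsetI F `&` fsetI G.
Proof. by rewrite /fsetI set_fsetU bigcap_setU. Qed.

Lemma fsetIU1 A F : fsetI (A |` F)%fset = A `&` fsetI F.
Proof. by rewrite /fsetI set_fsetU1 bigcap_setU1. Qed.

Lemma has_mean_density A r : has_mean R \1_A r -> density R A = r.
Proof. by move=> Ar; rewrite /density initial_densityE; exact: (cvg_lim _ Ar). Qed.

Lemma has_meanP A : density_family R A <-> exists r, has_mean R \1_A r.
Proof.
rewrite /density_family /= initial_densityE; split=> [Ac|[r Ar]].
  by exists (limn (mean R \1_A)).
exact: cvgP Ar.
Qed.

Lemma density_has_mean A : density_family R A -> has_mean R \1_A (density R A).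
Proof. by move=> /has_meanP[r Ar]; rewrite (has_mean_density _ _ Ar). Qed.

(** Products of indicators of finite intersections are again such, so this linear span is an
    algebra. It thus contains the indicators of the whole generated field, without normal forms for
    its members. *)
Inductive fsetI_span AA : (nat -> R) -> Prop :=
| fsetI_span_indic F : [set` F] `<=` AA -> fsetI_span AA \1_(fsetI F)
| fsetI_spanD f g : fsetI_span AA f -> fsetI_span AA g -> fsetI_span AA (f \+ g)
| fsetI_spanZ a f : fsetI_span AA f -> fsetI_span AA (a \*o f).

Lemma fsetI_spanM AA f g : fsetI_span AA f -> fsetI_span AA g -> fsetI_span AA (f \* g).
Proof.
move=> spf spg; elim: spf => {f} [F FA|f1 f2 _ IH1 _ IH2|a f _ IH]; last 2 first.
- rewrite (_ : _ \* g = (f1 \* g) \+ (f2 \* g)); first exact: fsetI_spanD.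
  by apply/funext => i /=; rewrite mulrDl.
- rewrite (_ : _ \* g = a \*o (f \* g)); first exact: fsetI_spanZ.
  by apply/funext => i /=; rewrite mulrA.
elim: spg => {g} [G GA|g1 g2 _ IH1 _ IH2|a g _ IH].
- rewrite -indicI -fsetIU; apply: fsetI_span_indic.
  by rewrite set_fsetU subUset.
- rewrite (_ : _ \* _ = (\1_(fsetI F) \* g1) \+ (\1_(fsetI F) \* g2)); first exact: fsetI_spanD.
  by apply/funext => i /=; rewrite mulrDr.
- rewrite (_ : _ \* _ = a \*o (\1_(fsetI F) \* g)); first exact: fsetI_spanZ.
  by apply/funext => i /=; rewrite mulrCA.
Qed.

Lemma fsetI_span_field AA : field_of_sets (fun A => fsetI_span AA \1_A).
Proof.
have spT : fsetI_span AA \1_setT.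
  by rewrite -fsetI0; apply: fsetI_span_indic; rewrite set_fset0.
split=> // [A B spA spB|A spA].
- rewrite (_ : \1_(A `|` B) = (\1_A \+ \1_B) \+ (-1 \*o (\1_A \* \1_B))).
    by apply: fsetI_spanD; [exact: fsetI_spanD|apply/fsetI_spanZ/fsetI_spanM].
  apply/funext => i /=; rewrite /indic in_setU.
  by case: (i \in A); case: (i \in B) => /=; ring.
- rewrite (_ : \1_(~` A) = \1_setT \+ (-1 \*o \1_A)).
    by apply: fsetI_spanD => //; exact: fsetI_spanZ.
  apply/funext => i /=; rewrite /indic in_setC in_setT.
  by case: (i \in A) => /=; ring.
Qed.

Lemma generated_field_density AA :
  (forall F, [set` F] `<=` AA -> density_family R (fsetI F)) ->
  generated_field AA `<=` density_family R.
Proof.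
move=> AAd; apply: subset_trans (_ : (fun A => fsetI_span AA \1_A) `<=` _).
  apply: smallest_sub; first exact: fsetI_span_field.
  move=> A AA_A; have := fsetI_span_indic AA [fset A]%fset.
  rewrite /fsetI set_fset1 bigcap_set1; apply => _ -> //.
move=> A; rewrite has_meanP; elim=> [F FA|f g _ [r fr] _ [s gs]|a f _ [r fr]].
- exact/has_meanP/AAd.
- by exists (r + s); exact: has_meanD.
- by exists (a * r); exact: has_meanZ.
Qed.

Lemma generated_field_fsetI AA F : [set` F] `<=` AA -> generated_field AA (fsetI F).
Proof.
elim/finSet_rect: F => F IH FA; have [->|[A AF]] := fset_0Vmem F.
  by rewrite fsetI0 => G [[GT _ _] _].
rewrite -(fsetD1K AF) fsetIU1 => G [[GT GU GC] AG].
have GA : G A by apply/AG/FA.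
have GF : G (fsetI (F `\ A)%fset).
  apply: (IH _ (fproperD1 AF)); last by split.
  by apply: subset_trans FA => B /=; rewrite !inE => /andP[].
by rewrite -[_ `&` _]setCK setCI; apply/GC/GU; exact: GC.
Qed.

Lemma d_independent_mean BB F : d_independent R BB -> [set` F] `<=` BB ->
  has_mean R \1_(fsetI F) (\prod_(A <- F) density R A).
Proof.
move=> [_ [_ [_ fieldD prodD]]] FB.
have [->|F0] := eqVneq F fset0.
  by rewrite fsetI0 big_seq_fset0 indicT; exact: has_mean1.
rewrite -prodD//; apply: density_has_mean; apply: fieldD.
exact: generated_field_fsetI.
Qed.

(** Existence and value of the densities in one clause; the empty family is allowed, so the
    recursion can start from it. *)
Definition half_independent AA := forall F, [set` F] `<=` AA ->
  has_mean R \1_(fsetI F) (2^-1 ^+ #|` F|).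

Lemma half_independent_density AA A : half_independent AA -> AA A ->
  has_mean R \1_A 2^-1.
Proof.
move=> hA AA_A; have := hA [fset A]%fset.
by rewrite /fsetI set_fset1 bigcap_set1 cardfs1 expr1; apply => _ ->.
Qed.

Lemma half_independentW AA : AA !=set0 -> half_independent AA -> d_independent R AA.
Proof.
move=> AA0 hA; have dA A : AA A -> density R A = 2^-1.
  by move=> /(half_independent_density _ _ hA)/has_mean_density.
split=> //; split=> [A /(half_independent_density _ _ hA) Ah|].
  by apply/has_meanP; exists 2^-1.
split=> [A /dA ->|| F _ FA].
- by apply/andP; split; lra.
- apply: generated_field_density => F FA; apply/has_meanP.
  by exists (2^-1 ^+ #|` F|); exact: hA.
- rewrite (has_mean_density _ _ (hA _ FA)) big_seq (eq_bigr (fun=> 2^-1)).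
    by rewrite -big_seq big_const_seq count_predT iter_mulr_1.
  by move=> A /FA /dA.
Qed.

Lemma half_independentU1 AA Y : half_independent AA ->
  (forall F, [set` F] `<=` AA -> has_mean R \1_(Y `&` fsetI F) (2^-1 ^+ #|` F|.+1)) ->
  half_independent (AA `|` [set Y]).
Proof.
move=> hA hY F FAY; have [YF|YF] := boolP (Y \in F); last first.
  apply: hA => A /= AF; case: (FAY _ AF) => [//|/= AY].
  by rewrite -AY AF in YF.
rewrite -(fsetD1K YF) fsetIU1 cardfsU1 !inE eqxx /= add1n.
apply: hY => A /=; rewrite !inE => /andP[AY AF].
by case: (FAY _ AF) => // /= /eqP; rewrite (negbTE AY).
Qed.

(** A nonempty finite subset of the union of a chain lies in one member; the empty [F] is treated
    apart because the chain may be empty. *)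
Lemma half_independent_bigcup (I : set (set (set nat))) : total_on I subset ->
  (forall AA, I AA -> half_independent AA) ->
  half_independent (\bigcup_(AA in I) AA).
Proof.
move=> totI hI F FI; have [->|F0] := eqVneq F fset0.
  by rewrite fsetI0 cardfs0 expr0 indicT; exact: has_mean1.
suff [AA IAA FAA] : exists2 AA, I AA & [set` F] `<=` AA by exact: hI FAA.
elim/finSet_rect: F FI F0 => F IH FI F0; have [F00|[A AF]] := fset_0Vmem F.
  by rewrite F00 eqxx in F0.
have [B IB BA] := FI _ AF.
have [FA0|FA0] := eqVneq (F `\ A)%fset fset0.
  exists B => //; rewrite -(fsetD1K AF) FA0 fsetU0 => C /=.
  by rewrite inE => /eqP ->.
have [|C IC FC] := IH _ (fproperD1 AF) _ FA0.
  by apply: subset_trans FI => C /=; rewrite !inE => /andP[].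
have [BC|CB] := totI _ _ IB IC.
- exists C => // D /= DF; have [->|DA] := eqVneq D A; first exact: BC.
  by apply: FC; rewrite /= !inE DA.
- exists B => // D /= DF; have [->//|DA] := eqVneq D A.
  by apply: CB; apply: FC; rewrite /= !inE DA.
Qed.

Hypothesis cov_null : forall S, null_cover R S -> ([set: nat -> bool] #<= S)%card.

(** Split all sets [Z & fsetI F] in the ratio 1 / (2 e), which is at most 1 because e >= 1/2. *)
Lemma exists_half_subset AA Z (e : R) : small_family AA -> 2^-1 <= e ->
  (forall F, [set` F] `<=` AA -> has_mean R \1_(Z `&` fsetI F) (e * 2^-1 ^+ #|` F|)) ->
  exists2 Y, Y `<=` Z &
    forall F, [set` F] `<=` AA -> has_mean R \1_(Y `&` fsetI F) (2^-1 ^+ #|` F|.+1).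
Proof.
move=> smallA e2 hZ; have e0 : 0 < e by apply: lt_le_trans e2; rewrite invr_gt0.
pose BB := (fun F => Z `&` fsetI F) @` [set F : {fset set nat} | [set` F] `<=` AA].
have smallB : small_family BB.
  move=> cB; apply: (card_le_seq _ _ _ cantor_uncountable smallA).
  pose h (s : seq (set nat)) := Z `&` \bigcap_(A in [set` s]) A.
  have BBh : (BB #<= h @` [set s : seq (set nat) | [set` s] `<=` AA])%card.
    by apply: subset_card_le => _ [F FA <-]; exists F.
  exact: card_le_trans cB (card_le_trans BBh (card_image_le h _)).
have [|T hT] := exists_splitting R cov_null BB (2^-1 / e) smallB.
  apply/andP; split; last by rewrite ler_pdivrMr// mul1r.
  by apply: divr_ge0; [rewrite invr_ge0|exact: ltW].
exists (Z `&` T); first exact: subIsetl.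
move=> F FA; have := hT (Z `&` fsetI F) _ _ (hZ F FA).
rewrite setIAC exprS mulrA divfK ?gt_eqF//; apply.
by exists F.
Qed.

Definition spoils AA X Y :=
  (forall F, [set` F] `<=` AA -> has_mean R \1_(Y `&` fsetI F) (2^-1 ^+ #|` F|.+1)) /\
  ~ has_mean R \1_(X `&` Y) (density R X / 2).

(** Y is taken inside X or inside its complement, whichever has density at least 1/2. Then X & Y has
    density 1/2 or 0, and neither equals d / 2 as 0 < d < 1. *)
Lemma exists_spoils AA X : small_family AA -> half_independent AA ->
  0 < density R X < 1 ->
  (forall F, [set` F] `<=` AA ->
    has_mean R \1_(X `&` fsetI F) (density R X * 2^-1 ^+ #|` F|)) ->
  exists Y, spoils AA X Y.
Proof.
set d := density R X => smallA hA /andP[d0 d1] hX.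
have [d2|/ltW d2] := leP 2^-1 d.
  have [Y YX hY] := exists_half_subset AA X d smallA d2 hX.
  exists Y; split=> //; rewrite setIidr// => Yd.
  have := hY fset0; rewrite set_fset0 fsetI0 setIT cardfs0 expr1 => /(_ (@sub0set _ _)).
  by move=> /(has_mean_unique _ _ _ _ Yd); rewrite -/d; lra.
have [|F FA|Y YX hY] := exists_half_subset AA (~` X) (1 - d) smallA.
- lra.
- rewrite setIC -setDE mulrBl mul1r; apply: has_mean_setD; first exact: hA.
  by rewrite setIC; exact: hX.
exists Y; split=> //; rewrite (_ : X `&` Y = set0); last first.
  by apply/seteqP; split=> // i [Xi /YX].
by rewrite indic0 => /(has_mean_unique _ _ _ _ (has_mean0 R)); rewrite -/d; lra.
Qed.

End independence.

(** * The transfinite recursion and maximality *)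

Section recursion.
Context (R : realType) (lt : set nat -> set nat -> Prop).
Hypotheses (lt_wo : strict_well_order _ lt)
  (lt_small : forall X, small_family [set Y | lt Y X])
  (cov_null : forall S, null_cover R S -> ([set: nat -> bool] #<= S)%card).

Lemma wf_lt : well_founded lt. Proof. by case: lt_wo. Qed.

(** A singleton if a spoiler exists and empty otherwise: the first conjunct discards the default
    value of [get]. *)
Definition pick_spoiler (AA : set (set nat)) X : set (set nat) :=
  [set Y | spoils R AA X Y /\ Y = get (spoils R AA X)].

Definition stage : set nat -> set (set nat) :=
  Fix wf_lt (fun=> set (set nat)) (fun X rec =>
    pick_spoiler [set Y | exists X' (h : lt X' X), rec X' h Y] X).

Definition before X := \bigcup_(X' in [set X' | lt X' X]) stage X'.

Lemma stageE X : stage X = pick_spoiler (before X) X.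
Proof.
rewrite {1}/stage Fix_eq => [|X' f g fg].
  congr pick_spoiler; apply/seteqP; split=> Y; first by move=> [X' [h sY]]; exists X'.
  by move=> [X' h sY]; exists X', h.
by congr pick_spoiler; apply/seteqP; split=> Y [Z [h fY]]; exists Z, h; rewrite ?fg// -fg.
Qed.

(** The sets added before X are among the images of earlier indices under one choice function. *)
Lemma small_before X : small_family (before X).
Proof.
move=> cX; apply: (lt_small X); apply: card_le_trans cX _.
apply: card_le_trans (card_image_le (fun X' => get (spoils R (before X') X')) _).
by apply: subset_card_le => Y [X' X'X]; rewrite stageE => -[_ ->]; exists X'.
Qed.

Lemma stage_before X' X : lt X' X -> before X' `|` stage X' `<=` before X.
Proof.
case: lt_wo => _ lt_trans _ X'X Y [[Z ZX' ZY]|X'Y]; last by exists X'.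
by exists Z => //; exact: lt_trans X'X.
Qed.

Lemma stage_chain (I : set (set nat)) :
  total_on [set before X `|` stage X | X in I] subset.
Proof.
case: lt_wo => _ _ tri _ _ [X _ <-] [Y _ <-].
have [XY|->|YX] := tri X Y; [left|by left|right].
- by apply: subset_trans (stage_before _ _ XY) _; exact: subsetUl.
- by apply: subset_trans (stage_before _ _ YX) _; exact: subsetUl.
Qed.

(** Presents the union of the stages as the union of a chain, the form that
    [half_independent_bigcup] takes. *)
Lemma bigcup_stage (I : set (set nat)) :
  (forall X Y, I X -> lt Y X -> I Y) ->
  \bigcup_(X in I) stage X = \bigcup_(AA in [set before X `|` stage X | X in I]) AA.
Proof.
move=> Idown; apply/seteqP; split=> Y.
  by move=> [X IX XY]; exists (before X `|` stage X); [exists X|right].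
by move=> [_ [X IX <-] [[Z ZX ZY]|XY]]; [exists Z => //; exact: Idown ZX|exists X].
Qed.

Lemma half_independent_stage X : half_independent R (before X `|` stage X).
Proof.
elim/(well_founded_ind wf_lt): X => X IH.
have hX : half_independent R (before X).
  rewrite /before bigcup_stage; last first.
    by case: lt_wo => _ lt_trans _ Y Z YX ZY; exact: lt_trans YX.
  apply: half_independent_bigcup; first exact: stage_chain.
  by move=> _ [X' /IH + <-].
have [[Y XY]|none] := pselect (stage X !=set0).
  rewrite (_ : stage X = [set Y]).
    apply: half_independentU1 => //.
    by move: XY; rewrite stageE => -[[]].
  move: XY; rewrite stageE => -[sY Yget].
  by apply/seteqP; split=> Z => [[_ ->]|->].
rewrite (_ : stage X = set0) ?setU0//.
by apply/seteqP; split=> // Y XY; apply: none; exists Y.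
Qed.

Lemma half_independent_before X : half_independent R (before X).
Proof.
by move=> F FX; apply: (half_independent_stage X) => A /FX; left.
Qed.

Lemma half_independent_stages : half_independent R (\bigcup_X stage X).
Proof.
rewrite bigcup_stage//; apply: half_independent_bigcup; first exact: stage_chain.
by move=> _ [X _ <-]; exact: half_independent_stage.
Qed.

Lemma stage_nonempty X : 0 < density R X < 1 ->
  (forall F : {fset set nat}, [set` F] `<=` before X ->
    has_mean R \1_(X `&` fsetI F) (density R X * 2^-1 ^+ #|` F|)) ->
  exists2 Y, stage X Y & ~ has_mean R \1_(X `&` Y) (density R X / 2).
Proof.
move=> dX hX.
have exY := exists_spoils R cov_null _ _ (small_before X) (half_independent_before X) dX hX.
exists (get (spoils R (before X) X)); last exact: (getPex exY).2.
by rewrite stageE; split=> //; exact: getPex.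
Qed.

(** Take any X of density 1/2. If nothing precedes it, the hypothesis of [stage_nonempty] concerns
    only the empty intersection, so stage X adds a set. *)
Lemma stages_nonempty : \bigcup_X stage X !=set0.
Proof.
have small1 : small_family [set setT].
  move=> c1; apply: cantor_uncountable; apply: card_le_trans c1 _.
  exact: countable1.
have [X /(_ setT erefl)] := exists_fair_splitting R cov_null _ small1.
rewrite indicT setTI => /(_ _ (has_mean1 R)); rewrite mul1r => hX.
have dX := has_mean_density _ _ _ hX.
have [[Y [Z _ ZY]]|bX] := pselect (before X !=set0); first by exists Y, Z.
have [| F FX|Y XY _] := stage_nonempty X.
- by rewrite dX; apply/andP; split; lra.
- have -> : F = fset0.
    apply/eqP/fset0Pn => -[A AF]; apply: bX; exists A; exact: FX.
  by rewrite fsetI0 setIT cardfs0 expr0 mulr1 dX.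
- by exists Y, X.
Qed.

Lemma stages_maximal BB : d_independent R BB -> \bigcup_X stage X `<=` BB ->
  BB = \bigcup_X stage X.
Proof.
move=> indB AB; apply/seteqP; split=> // X BX; apply: contrapT => nX.
have dens A : (\bigcup_X stage X) A -> density R A = 2^-1.
  by move=> /(half_independent_density _ _ _ half_independent_stages)/has_mean_density.
have beforeS : before X `<=` \bigcup_X stage X by move=> Y [Z _ ZY]; exists Z.
have [|F FX|Y XY []] := stage_nonempty X.
- by case: indB => _ [_ [+ _ _]]; apply.
(* X lies outside the union, so it is a separate factor in the product rule of [BB], both here with
   [F] and below with Y. *)
- have XF : X \notin F by apply/negP => /FX/beforeS.
  have := d_independent_mean R BB (X |` F)%fset indB.
  rewrite fsetIU1 big_fsetU1//= big_seq (eq_bigr (fun=> 2^-1)); last first.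
    by move=> A /FX/beforeS/dens.
  rewrite -big_seq big_const_seq count_predT iter_mulr_1; apply.
  by rewrite set_fsetU1 subUset; split=> [_ -> //|A /FX/beforeS/AB].
- have AY : (\bigcup_X stage X) Y by exists X.
  have XY' : X \notin [fset Y]%fset.
    by rewrite inE; apply/eqP => XeY; apply: nX; rewrite XeY.
  have := d_independent_mean R BB (X |` [fset Y])%fset indB.
  rewrite fsetIU1 big_fsetU1//= big_seq_fset1 /fsetI set_fset1 bigcap_set1 (dens Y)//.
  by apply; rewrite set_fsetU1 set_fset1 subUset; split=> _ ->; [|exact: AB].
Qed.

End recursion.

Theorem corollary2p10 (R : realType)
    (cov_null_continuum : cov_null_is R [set: nat -> bool]) :
  exists AA : set (set nat),
    maximal_d_independent R AA /\
    forall A : set nat, AA A -> density R A = 2^-1.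
Proof.
have [_ cov_null] := cov_null_continuum.
have [lt lt_wo lt_big] := initial_well_ordering (set nat).
have lt_small X : small_family [set Y | lt Y X].
  move=> c; apply: (lt_big X); apply: card_le_trans c.
  (* Characteristic functions pass from [set nat], which indexes the recursion, to [nat -> bool],
     which measures smallness. *)
  pose chi (A : set nat) n := `[< A n >].
  apply/card_le_injP; exists chi => // A B _ _ AB.
  by apply/predeqP => n; exact: asbool_eq_equiv (congr1 (@^~ n) AB).
have hA := half_independent_stages R lt lt_wo.
exists (\bigcup_X stage R lt lt_wo X); split; last first.
  by move=> A /(half_independent_density _ _ _ hA)/has_mean_density.
split; last exact: stages_maximal.
exact: half_independentW (stages_nonempty _ _ _ _ _) hA.
Qed.
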